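(* Let $B$ be a standard one-dimensional Brownian motion and let $f\colon \mathbb{R}^+\to\mathbb{R}$ be a function which is $1/2$-Hölder continuous on compact intervals. Then, almost surely, the set $\mathcal{Z}(B-f)=\{t>0: B(t)=f(t)\}$ has no isolated points.
   Context: $\mathbb{R}^+=[0,\infty)$; $B=(B(t))_{t\ge 0}$ starts at $0$. For a real function $g$ on (a subset of) $\mathbb{R}^+$, $\mathcal{Z}(g)$ denotes the set of zeros of $g$ in $(0,\infty)$ (the origin is excluded). ''$1/2$-Hölder continuous on compact intervals'' means that for each compact interval $K\subset\mathbb{R}^+$ there is a constant $C_K$ with $|f(t)-f(s)|\le C_K|t-s|^{1/2}$ for all $s,t\in K$. *)

(* Defs.v *)
From HB Require Import structures.
From mathcomp Require Import all_boot all_order all_algebra.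
From mathcomp Require Import all_classical all_reals all_analysis.
From mathcomp Require Import measurable_realfun.

Set Implicit Arguments.
Unset Strict Implicit.
Unset Printing Implicit Defensive.

Import Order.TTheory GRing.Theory Num.Theory.
Import numFieldNormedType.Exports.

Local Open Scope classical_set_scope.
Local Open Scope ring_scope.

(* As some of the [A i] may be [setT], the product rule over the whole finite
   index type contains the product rule over every subfamily. *)
Definition independent_RVs (d : measure_display) (T : measurableType d)
    (R : realType) (P : probability T R) (I : finType)
    (X : I -> {RV P >-> R}) : Prop :=
  forall A : I -> set R, (forall i, measurable (A i)) ->
    P (\bigcap_i (X i @^-1` A i)) = (\prod_i P (X i @^-1` A i))%E.

(* Time is [0, +oo[: the values of the process at negative times are
   unconstrained.  The second parameter of [normal_prob] is the standard
   deviation, and [normal_prob 0 0] is not the Dirac mass at 0, whence [s < t]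
   in [bm_gaussian]. *)
Record standard_brownian_motion (d : measure_display) (T : measurableType d)
    (R : realType) (P : probability T R) (B : R -> {RV P >-> R}) : Prop := {
  bm_start : {ae P, forall w, B 0 w = 0};
  bm_independent : forall (t : R^nat) (n : nat),
    0 <= t 0%N -> nondecreasing_seq t ->
    independent_RVs (fun i : 'I_n => B (t i.+1) - B (t i) : {RV P >-> R});
  bm_gaussian : forall s t : R, 0 <= s -> s < t ->
    forall A : set R, measurable A ->
      distribution P (B t - B s : {RV P >-> R}) A
      = normal_prob 0 (Num.sqrt (t - s)) A;
  bm_continuous : {ae P, forall w,
    {within `[0, +oo[, continuous (fun t : R => B t w)}}
}.

Definition half_holder_on_compacts (R : realType) (f : R -> R) : Prop :=
  forall a b : R, 0 <= a -> a <= b ->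
    exists C : R, forall s t : R, s \in `[a, b] -> t \in `[a, b] ->
      `|f t - f s| <= C * `|t - s| `^ 2^-1.

Definition zeros (R : realType) (g : R -> R) : set R :=
  [set t | 0 < t /\ g t = 0].

(* Main.v *)
Require Import Defs.
From mathcomp Require Import all_boot all_order all_algebra.
From mathcomp Require Import all_classical all_reals all_analysis.
From mathcomp Require Import measurable_realfun lra ring.
Import Order.TTheory GRing.Theory Num.Theory.
Import numFieldNormedType.Exports.
Local Open Scope classical_set_scope.
Local Open Scope ring_scope.

Set Implicit Arguments.
Unset Strict Implicit.
Unset Printing Implicit Defensive.

(* An isolated zero [t] of [B - f] would be a first zero after some rational
   [q < t], followed by a rational stretch on which [B - f] keeps one sign [e].
   For small [eps], the first point [s] of a fine grid at which
   [|B - f| <= eps] then satisfies [e (B (s + h) - B s) >= - (C + 1) sqrt h] for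
   any prescribed finite set of scales [h], [C] being a Hoelder constant of [f].
   On a grid "first" is a finite disjoint union of events in the past of [s], so
   independence of increments replaces the strong Markov property; along a
   rapidly growing geometric sequence of scales the increments are essentially
   independent, and each one violates the bound with probability bounded below.
   Hence this event has arbitrarily small probability, uniformly in [eps] and in
   the grid. *)

(** * Estimates for centred normal laws *)

Lemma measurable_normr_gt (R : realType) (a : R) :
  measurable [set x : R | a < `|x|].
Proof.
rewrite [X in measurable X](_ : _ = Num.norm @^-1` `]a, +oo[); last first.
  by apply/seteqP; split => x /=; rewrite in_itv/= andbT.
by rewrite -[X in measurable X]setTI; exact: normr_measurable.
Qed.

Lemma measurable_mul_ge (R : realType) (e b : R) :
  measurable [set x : R | b <= e * x].
Proof.
rewrite [X in measurable X](_ : _ = *%R e @^-1` `[b, +oo[); last first.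
  by apply/seteqP; split => x /=; rewrite in_itv/= andbT.
by rewrite -[X in measurable X]setTI; exact: mulrl_measurable.
Qed.

Lemma normal_peak_double (R : realType) (s : R) :
  normal_peak s = 2 * normal_peak (2 * s).
Proof.
rewrite /normal_peak (_ : (2 * s) ^+ 2 * pi *+ 2 = 2 ^+ 2 * (s ^+ 2 * pi *+ 2));
  last by ring.
by rewrite sqrtrM ?sqr_ge0// sqrtr_sqr ger0_norm// invfM mulVKf.
Qed.

(* Off [-a, a] the density of N(0, s) is at most [6 (s / a)^2] times the density
   of N(0, 2s), whose total mass is 1. *)
Lemma normal_prob_tail (R : realType) (s a : R) : 0 < s -> 0 < a ->
  (normal_prob 0 s [set x | (a < `|x|)%R] <= (6 * (s ^+ 2 / a ^+ 2))%:E)%E.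
Proof.
move=> s0 a0; have s20 : 0 < 2 * s by rewrite mulr_gt0.
set A := [set x : R | a < `|x|].
have mA : measurable A by exact: measurable_normr_gt.
pose c := 6 * (s ^+ 2 / a ^+ 2).
have c0 : 0 <= c by rewrite /c mulr_ge0// divr_ge0 ?sqr_ge0.
apply: (@le_trans _ _ (c%:E * normal_prob 0 (2 * s)%R A)%E);
    last by rewrite -[leRHS]mule1 lee_wpmul2l// ?lee_fin// probability_le1.
rewrite /normal_prob -ge0_integralZl//=; first last.
- by move=> x _; rewrite lee_fin normal_pdf_ge0.
- by apply/measurable_EFinP/measurable_funTS; exact: measurable_normal_pdf.
apply: ge0_le_integral => //=.
- by move=> x _; rewrite lee_fin normal_pdf_ge0.
- by apply/measurable_EFinP/measurable_funTS; exact: measurable_normal_pdf.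
- apply/measurable_EFinP/measurable_funTS/measurable_funM => //.
  exact: measurable_normal_pdf.
move=> x /= ax; rewrite -EFinM lee_fin !normal_pdfE ?gt_eqF//.
rewrite normal_peak_double [leRHS]mulrCA [leRHS]mulrC [leLHS]mulrAC.
apply: ler_wpM2r; first exact: normal_peak_ge0.
rewrite /normal_fun !subr0.
have ax2 : a ^+ 2 <= x ^+ 2.
  by rewrite -(real_normK (num_real x)) ler_sqr ?nnegrE ?ltW// (lt_trans a0).
set u := x ^+ 2 / s ^+ 2.
(* As [u / 8] is the exponent for N(0, 2s), a factor exp(- 3u/8) is left. By [expR_ge1Dx] it is at
   most 8/3 times [s^2 / a^2], and the ratio 2 of the peaks makes this 16/3 <= 6. *)
have -> : - x ^+ 2 / (s ^+ 2 *+ 2) = - (3 / 8 * u) + - (u / 8).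
  by rewrite /u; field; rewrite gt_eqF.
have -> : - x ^+ 2 / ((2 * s) ^+ 2 *+ 2) = - (u / 8).
  by rewrite /u; field; rewrite gt_eqF.
rewrite expRD mulrA; apply: ler_wpM2r; first exact: expR_ge0.
have u0 : 0 < a ^+ 2 / s ^+ 2 by rewrite divr_gt0// exprn_gt0.
have au : a ^+ 2 / s ^+ 2 <= u by rewrite /u ler_pM2r// invr_gt0 exprn_gt0.
have cE : c = 6 * (a ^+ 2 / s ^+ 2)^-1 by rewrite /c invf_div.
rewrite cE expRN.
apply: (@le_trans _ _ (2 * (3 / 8 * (a ^+ 2 / s ^+ 2))^-1)).
  rewrite ler_pM2l// lef_pV2 ?posrE ?expR_gt0//; last by lra.
  by apply: le_trans (expR_ge1Dx _); lra.
rewrite invfM; set v := (a ^+ 2 / s ^+ 2)^-1.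
have : 0 < v by rewrite invr_gt0.
by lra.
Qed.

(** The interval lies in [-cs, cs], where the density is at least exp(- c^2/2) / (s sqrt(2 pi)); its
    length [s] cancels the denominator, so the bound is free of the scale. *)
Lemma normal_prob_itv_ge (R : realType) (c s u : R) : 0 < s ->
  `|u| <= c * s -> `|u + s| <= c * s ->
  ((expR (- (c ^+ 2 / 2)) / Num.sqrt (pi *+ 2))%:E
     <= normal_prob 0 s `]u, (u + s)%R[%classic)%E.
Proof.
move=> s0 us uss.
have sp : Num.sqrt (s ^+ 2 * pi *+ 2) = s * Num.sqrt (pi *+ 2).
  by rewrite -mulrnAr sqrtrM ?sqr_ge0// sqrtr_sqr gtr0_norm.
have pi2 : 0 < Num.sqrt (pi *+ 2 : R) by rewrite sqrtr_gt0 mulrn_wgt0// pi_gt0.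
pose k := normal_peak s * expR (- (c ^+ 2 / 2)).
have -> : (expR (- (c ^+ 2 / 2)) / Num.sqrt (pi *+ 2))%:E
    = (\int[lebesgue_measure]_(x in `]u, (u + s)%R[) k%:E)%E.
  rewrite integral_cst//= lebesgue_measure_itv/= lte_fin ltrDl s0.
  rewrite -EFinD -EFinM; congr (_%:E); rewrite /k /normal_peak sp.
  by field; rewrite !gt_eqF.
apply: ge0_le_integral => //=.
- by move=> x _; rewrite lee_fin mulr_ge0 ?normal_peak_ge0 ?expR_ge0.
- by apply/measurable_EFinP/measurable_funTS; exact: measurable_normal_pdf.
move=> x; rewrite in_itv/= => /andP[ux xu].
rewrite lee_fin normal_pdfE ?gt_eqF// ler_wpM2l ?normal_peak_ge0//.
rewrite /normal_fun subr0 ler_expR mulNr lerN2.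
rewrite ler_pdivrMr ?mulrn_wgt0 ?exprn_gt0//.
rewrite (_ : _ / _ * _ = (c * s) ^+ 2); last by field.
rewrite -(real_normK (num_real x)) ler_sqr ?nnegrE//; last first.
  by rewrite (le_trans _ us).
by move: us uss; rewrite !ler_norml => /andP[? ?] /andP[? ?]; apply/andP; lra.
Qed.

(** * Independence of the past and the future *)

(** The measurable events independent of [F] form a Dynkin system, so by the pi-lambda theorem it is
    enough to test a pi-system. *)
Lemma sigma_algebra_independent (d : measure_display) (T : measurableType d)
    (R : realType) (P : probability T R) (G : set (set T)) (F : set T) :
  setI_closed G -> measurable F ->
  (forall A, G A -> measurable A /\ P (A `&` F) = (P A * P F)%E) ->
  forall A, <<s G >> A -> measurable A /\ P (A `&` F) = (P A * P F)%E.
Proof.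
move=> GI mF GF.
suff : <<s G >> `<=` [set A | measurable A /\ P (A `&` F) = (P A * P F)%E] by [].
apply: lambda_system_subset => //; apply/dynkin_lambda_system; split => /=.
- by split => //; rewrite setTI probability_setT mul1e.
- move=> A [mA AF]; split; first exact: measurableC.
  rewrite setIC -setDE measureD// ?ltey_eq ?fin_num_measure//.
  rewrite [X in (_ - P X)%E]setIC AF probability_setC// muleBl ?mul1e ?fin_num_measure//.
- move=> A tA mA; split; first by apply: bigcup_measurable => k _; have [] := mA k.
  rewrite setI_bigcupl measure_bigcup//; first last.
  - exact: trivIset_setIr.
  - by move=> k _; apply: measurableI => //; have [] := mA k.
  rewrite measure_bigcup//; last by move=> k _; have [] := mA k.
  have /fineK PFE := fin_num_measure P F mF.
  rewrite [RHS]muleC -PFE -nneseriesZl//.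
  by apply: eq_eseriesr => i _; rewrite PFE muleC; have [] := mA i.
Qed.

(** A pi-system generating the sigma-algebra of the first [n] variables. Indexing the sides by [nat]
    avoids casts between ordinals when rectangles are glued. *)
Definition rectangles (R : realType) (T : Type) (X : nat -> T -> R) (n : nat)
    : set (set T) :=
  [set A | exists2 C : nat -> set R, (forall j, measurable (C j)) &
     A = [set w | forall j, (j < n)%N -> C j (X j w)]].

Lemma eq_rectangles (R : realType) (T : Type) (X Y : nat -> T -> R) (n : nat) :
  (forall j w, (j < n)%N -> X j w = Y j w) -> rectangles X n = rectangles Y n.
Proof.
move=> XY; apply/seteqP; split => A [C mC ->]; exists C => //;
  by apply/seteqP; split => w H j jn; have := H j jn; rewrite XY.
Qed.

Lemma rectangles_setI_closed (R : realType) (T : Type) (X : nat -> T -> R) n :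
  setI_closed (rectangles X n).
Proof.
move=> _ _ [C mC ->] [D mD ->]; exists (fun j => C j `&` D j).
  by move=> j; exact: measurableI.
apply/seteqP; split => w /=; last by move=> H; split => j /H[].
by move=> [HC HD] j jn; split; [exact: HC|exact: HD].
Qed.

Lemma measurable_fun_rectangles (R : realType) (T : pointedType)
    (X : nat -> T -> R) n j : (j < n)%N ->
  measurable_fun [set: g_sigma_algebraType (rectangles X n)] (X j).
Proof.
move=> jn _ Y mY; rewrite setTI; apply: sub_sigma_algebra.
exists (fun i => if i == j then Y else setT).
  by move=> i; case: ifP.
apply/seteqP; split => w /=; last by move/(_ j jn); rewrite eqxx.
by move=> Yw i _; case: eqP => // ->.
Qed.

Lemma measurable_rectangle (R : realType) (d : measure_display)
    (T : measurableType d) (X : nat -> T -> R) n (C : nat -> set R) :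
  (forall j, measurable_fun setT (X j)) -> (forall j, measurable (C j)) ->
  measurable [set w | forall j, (j < n)%N -> C j (X j w)].
Proof.
move=> mX mC.
rewrite [X in measurable X](_ : _ = \bigcap_(j in `I_n) (X j @^-1` C j))//.
apply: bigcap_measurableType => j _; rewrite -[X in measurable X]setTI.
exact: mX.
Qed.

(* The past is an arbitrary event of the sigma-algebra of the first [a]
   variables, the future only a rectangle in the next [b] ones. *)
Lemma independent_past_future (d : measure_display) (T : measurableType d)
    (R : realType) (P : probability T R) (X : nat -> {RV P >-> R}) (a b : nat)
    (C : nat -> set R) (A : set T) :
  independent_RVs (fun i : 'I_(a + b) => X i) -> (forall j, measurable (C j)) ->
  <<s rectangles (fun j => X j : T -> R) a >> A ->
  P (A `&` [set w | forall k, (k < b)%N -> C k (X (a + k)%N w)])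
    = (P A * \prod_(k < b) P (X (a + k)%N @^-1` C k))%E.
Proof.
move=> indX mC sA; set F := [set w | _].
have mF : measurable F by exact: (measurable_rectangle (X := fun k => X (a + k)%N)).
have prodE (D : nat -> set R) : (forall j, measurable (D j)) ->
    P [set w | forall j, (j < a + b)%N -> D j (X j w)] =
    (\prod_(i < a) P (X i @^-1` D i) *
      \prod_(k < b) P (X (a + k)%N @^-1` D (a + k)%N))%E.
  move=> mD; rewrite -(@big_split_ord _ _ _ _ _ xpredT (fun i : 'I_(a + b) => P (X i @^-1` D i))).
  rewrite -(indX (fun i => D i))//; congr (P _).
  apply/seteqP; split => w /= H; first by move=> i _; exact: H.
  by move=> j jab; exact: (H (Ordinal jab)).
(* [join D] has the sides of [D] before [a] and those of [C] from [a] on. It presents both [F] ([D]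
   constantly [setT]) and the intersection of a past rectangle with [F] as rectangles in all [a + b]
   variables. *)
pose join (D : nat -> set R) j := if (j < a)%N then D j else C (j - a)%N.
have PF : P F = (\prod_(k < b) P (X (a + k)%N @^-1` C k))%E.
  rewrite (_ : F = [set w | forall j, (j < a + b)%N -> join (fun=> setT) j (X j w)]).
    rewrite prodE; last by move=> j; rewrite /join; case: ifP.
    rewrite big1 ?mul1e => [|i _].
      by apply: eq_bigr => k _; rewrite /join ltnNge leq_addr/= addKn.
    by rewrite /join ltn_ord preimage_setT probability_setT.
  apply/seteqP; split => w /= H.
    move=> j jab; rewrite /join; case: ltnP => // aj.
    by have := H (j - a)%N; rewrite subnKC// ltn_subLR//; apply.
  move=> k kb; have := H (a + k)%N; rewrite ltn_add2l => /(_ kb).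
  by rewrite /join ltnNge leq_addr/= addKn.
rewrite -PF.
apply: (proj2 (sigma_algebra_independent (@rectangles_setI_closed _ _ _ _) mF _ sA)).
move=> _ [D mD ->].
have mA : measurable [set w | forall j, (j < a)%N -> D j (X j w)].
  exact: (measurable_rectangle (X := fun k => X k)).
split => //.
have PA : P [set w | forall j, (j < a)%N -> D j (X j w)]
    = (\prod_(i < a) P (X i @^-1` D i))%E.
  pose D' j := if (j < a)%N then D j else setT.
  rewrite (_ : [set w | _] = [set w | forall j, (j < a + b)%N -> D' j (X j w)]).
    rewrite prodE; last by move=> j; rewrite /D'; case: ifP.
    rewrite [X in (_ * X)%E]big1 ?mule1 => [|i _].
      by apply: eq_bigr => k _; rewrite /D' ltn_ord.
    by rewrite /D' ltnNge leq_addr/= preimage_setT probability_setT.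
  apply/seteqP; split => w /= H j ja.
    by rewrite /D'; case: ltnP => // ja'; exact: H.
  by have := H j; rewrite /D' ja; apply; exact: ltn_addr.
rewrite PA PF.
rewrite (_ : _ `&` _ = [set w | forall j, (j < a + b)%N -> join D j (X j w)]).
  rewrite prodE; last by move=> j; rewrite /join; case: ifP.
  congr (_ * _)%E; apply: eq_bigr => k _; first by rewrite /join ltn_ord.
  by rewrite /join ltnNge leq_addr/= addKn.
apply/seteqP; split => w /=.
  move=> [HD HF] j jab; rewrite /join; case: ltnP => aj; first exact: HD.
  by have := HF (j - a)%N; rewrite subnKC// ltn_subLR//; apply.
move=> H; split => [j ja|k kb].
  by have := H j; rewrite /join ja; apply; exact: ltn_addr.
have := H (a + k)%N; rewrite ltn_add2l => /(_ kb).
by rewrite /join ltnNge leq_addr/= addKn.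
Qed.

(** Following [s] up to index [a] and then [u] gives one nondecreasing sequence of times. Keeping
    [u] apart from [s] lets one past be combined with several choices of future times. *)
Lemma increments_past_future (d : measure_display) (T : measurableType d)
    (R : realType) (P : probability T R) (B : R -> {RV P >-> R})
    (s u : R^nat) (a b : nat) (C : nat -> set R) (A : set T) :
  standard_brownian_motion B ->
  0 <= s 0%N -> nondecreasing_seq s -> nondecreasing_seq u -> u 0%N = s a ->
  (forall j, measurable (C j)) ->
  <<s rectangles (fun j w => B (s j.+1) w - B (s j) w) a >> A ->
  P (A `&` [set w | forall k, (k < b)%N -> C k (B (u k.+1) w - B (u k) w)])
    = (P A * \prod_(k < b) P [set w | C k (B (u k.+1) w - B (u k) w)%R])%E.
Proof.
move=> hB s0 snd und us mC sA.
pose t j := if (j <= a)%N then s j else u (j - a)%N.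
have tu k : t (a + k)%N = u k.
  rewrite /t; case: leqP => [|_]; last by rewrite addKn.
  by rewrite -{2}(addn0 a) leq_add2l leqn0 => /eqP ->; rewrite addn0.
have tnd : nondecreasing_seq t.
  apply/nondecreasing_seqP => j; case: (leqP a j) => [aj|ja].
    rewrite -(subnKC aj) -addnS !tu; exact: und.
  by rewrite /t ja (ltnW ja); exact: snd.
pose X j : {RV P >-> R} := B (t j.+1) - B (t j).
have t0 : 0 <= t 0%N by rewrite /t leq0n.
have := @independent_past_future _ _ _ P X a b C A (bm_independent hB t0 tnd) mC.
have XE j w : X j w = B (t j.+1) w - B (t j) w by [].
have -> : rectangles (fun j => X j : T -> R) a =
          rectangles (fun j w => B (s j.+1) w - B (s j) w) a.
  by apply: eq_rectangles => j w ja; rewrite XE /t ja (ltnW ja).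
move=> /(_ sA); rewrite /preimage.
under eq_set do under eq_forall do rewrite XE -addnS !tu.
by under eq_bigr do under eq_set do rewrite XE -addnS !tu.
Qed.

(** * Staying above a square-root barrier *)

(** The bound of [normal_prob_itv_ge] for the interval between [c s] and [(c + 1) s], on either side
    of 0. *)
Definition escape_prob (R : realType) (c : R) : R :=
  expR (- ((c + 1) ^+ 2 / 2)) / Num.sqrt (pi *+ 2).

Lemma escape_prob_gt0 (R : realType) (c : R) : 0 < escape_prob c.
Proof. by rewrite divr_gt0 ?expR_gt0// sqrtr_gt0 mulrn_wgt0// pi_gt0. Qed.

Lemma normal_prob_escape (R : realType) (e c s : R) :
  e = 1 \/ e = -1 -> 0 < s -> 0 <= c ->
  (normal_prob 0 s [set x | (- (c * s) <= e * x)%R] <= (1 - escape_prob c)%:E)%E.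
Proof.
move=> e1 s0 c0; set A := [set x : R | _]; pose u := if e == 1 then - ((c + 1) * s) else c * s.
have mA : measurable A by exact: measurable_mul_ge.
have cs0 : 0 <= c * s by rewrite mulr_ge0// ltW.
have ub : `|u| <= (c + 1) * s /\ `|u + s| <= (c + 1) * s.
  by rewrite /u !ler_norml; case: eqP => _; split; apply/andP; split; lra.
have Au : `]u, (u + s)[%classic `<=` ~` A.
  move=> x; rewrite /A /u /= in_itv/= => /andP[].
  have [->|eN1] := eqVneq e 1.
    by move=> ? ?; apply/negP; rewrite -ltNge mul1r; lra.
  have -> : e = -1 by case: e1 eN1 => // ->; rewrite eqxx.
  by move=> ? ?; apply/negP; rewrite -ltNge mulN1r; lra.
have : ((escape_prob c)%:E <= normal_prob 0 s (~` A))%E.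
  apply: (le_trans (normal_prob_itv_ge s0 ub.1 ub.2)).
  by apply: le_measure; rewrite ?inE//; exact: measurableC.
have /fineK AE := fin_num_measure (normal_prob 0 s) A mA.
by rewrite probability_setC// -AE -EFinB lee_fin lerBrDl -lerBrDr -lee_fin AE.
Qed.

Lemma bm_increment_tail (d : measure_display) (T : measurableType d)
    (R : realType) (P : probability T R) (B : R -> {RV P >-> R}) (s t a : R) :
  standard_brownian_motion B -> 0 <= s -> s < t -> 0 < a ->
  (P [set w | (a < `|B t w - B s w|)%R] <= (6 * ((t - s) / a ^+ 2))%:E)%E.
Proof.
move=> hB s0 st a0.
have := bm_gaussian hB s0 st (measurable_normr_gt a); rewrite /distribution /pushforward => ->.
have ts : 0 < Num.sqrt (t - s) by rewrite sqrtr_gt0 subr_gt0.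
by have := normal_prob_tail ts a0; rewrite sqr_sqrtr// subr_ge0 ltW.
Qed.

Lemma bm_increment_escape (d : measure_display) (T : measurableType d)
    (R : realType) (P : probability T R) (B : R -> {RV P >-> R}) (e c s t a : R) :
  standard_brownian_motion B -> e = 1 \/ e = -1 -> 0 <= c ->
  0 <= s -> s < t -> a <= c * Num.sqrt (t - s) ->
  (P [set w | (- a <= e * (B t w - B s w))%R] <= (1 - escape_prob c)%:E)%E.
Proof.
move=> hB e1 c0 s0 st ac.
have := bm_gaussian hB s0 st (measurable_mul_ge e (- a)); rewrite /distribution /pushforward => ->.
have ts : 0 < Num.sqrt (t - s) by rewrite sqrtr_gt0 subr_gt0.
apply: le_trans (normal_prob_escape e1 ts c0).
apply: le_measure; rewrite ?inE; [exact: measurable_mul_ge..|].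
by move=> x /= ax; apply: le_trans ax; rewrite lerN2.
Qed.

Lemma prode_le_exp (R : realType) (m : nat) (x : nat -> \bar R) (c : R) :
  (forall k, (k < m)%N -> 0 <= x k /\ x k <= c%:E)%E ->
  (\prod_(k < m) x k <= (c ^+ m)%:E)%E.
Proof.
elim: m => [|m IH] xc; first by rewrite big_ord0 expr0.
rewrite big_ord_recr/= exprSr EFinM; apply: lee_pmul.
- by apply: prode_ge0 => k _; have [] := xc k (ltnW (ltn_ord k)).
- by have [] := xc m (ltnSn m).
- by apply: IH => k km; exact: (xc k (ltnW km)).
- by have [] := xc m (ltnSn m).
Qed.

Lemma measurable_past (d : measure_display) (T : measurableType d)
    (R : realType) (P : probability T R) (B : R -> {RV P >-> R}) (s : R^nat) n :
  <<s rectangles (fun j w => B (s j.+1) w - B (s j) w) n >> `<=` measurable.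
Proof.
apply: smallest_sub; first exact: sigma_algebra_measurable.
move=> _ [C mC ->].
apply: (measurable_rectangle (X := fun j w => B (s j.+1) w - B (s j) w)) => //.
by move=> j; exact: measurable_funB.
Qed.

(* Staying above [- K sqrt h] at all the times [h = g k] forces either an
   unusually large increment over some [0, g k], or every one of the independent
   increments over the [g k, g k.+1] to avoid a set of probability at least
   [escape_prob (2 K + 2)]. *)
Lemma bm_stay_le (d : measure_display) (T : measurableType d) (R : realType)
    (P : probability T R) (B : R -> {RV P >-> R}) (s g : R^nat) (a m : nat)
    (e K rho : R) (A : set T) :
  standard_brownian_motion B -> e = 1 \/ e = -1 -> 0 <= K -> rho <= 2^-1 ->
  0 <= s 0%N -> nondecreasing_seq s ->
  (forall k, 0 < g k) -> nondecreasing_seq g ->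
  (forall k, (k < m)%N -> g k <= rho * g k.+1) ->
  <<s rectangles (fun j w => B (s j.+1) w - B (s j) w) a >> A ->
  (P (A `&` [set w | forall k, (k <= m)%N ->
        (- (K * Num.sqrt (g k)) <= e * (B (s a + g k) w - B (s a) w))%R])
    <= P A * ((1 - escape_prob (2 * K + 2)) ^+ m + m%:R * (6 * rho))%:E)%E.
Proof.
move=> hB e1 K0 rho2 s0 snd g0 gnd grho sA.
set v := s a; have v0 : 0 <= v by rewrite (le_trans s0)//; exact: snd.
have c0 : 0 <= 2 * K + 2 by lra.
have mA : measurable A by exact: (@measurable_past _ _ _ _ B s a).
(* The future times are [v], [v + g 0], [v + g 1], ...; the increment up to [v + g 0] is left free
   by [C 0 = setT], so [m.+1] increments give [m] factors. *)
pose u j := if j is k.+1 then v + g k else v.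
have und : nondecreasing_seq u.
  apply/nondecreasing_seqP => -[|k]/=; first by rewrite lerDl ltW.
  by rewrite lerD2l; exact: gnd.
pose C j := if j is k.+1 then [set x : R | - ((K + 1) * Num.sqrt (g k.+1)) <= e * x] else setT.
have mC j : measurable (C j) by case: j => [|k] /=; [|exact: measurable_mul_ge].
pose X := [set w | forall k, (k < m.+1)%N -> C k (B (u k.+1) w - B (u k) w)].
pose Y k := [set w | Num.sqrt (g k.+1) < `|B (v + g k) w - B v w|].
have mX : measurable X.
  apply: (measurable_rectangle (X := fun j w => B (u j.+1) w - B (u j) w)) => //.
  by move=> j; exact: measurable_funB.
have mY k : measurable (Y k).
  rewrite /Y [X in measurable X](_ : _ = setT `&` (B (v + g k) \- B v) @^-1`
    [set x | Num.sqrt (g k.+1) < `|x|]); last by rewrite setTI.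
  by apply: measurable_funB => //; exact: measurable_normr_gt.
have PX : (P (A `&` X) <= P A * ((1 - escape_prob (2 * K + 2)) ^+ m)%:E)%E.
  rewrite (increments_past_future m.+1 hB s0 snd und erefl mC sA).
  apply: lee_wpmul2l; first exact: measure_ge0.
  rewrite big_ord_recl [X in (P X * _)%E](_ : _ = setT); last first.
    by apply/seteqP; split.
  rewrite probability_setT mul1e.
  apply: (@prode_le_exp _ m (fun k => P [set w | (- ((K + 1) * Num.sqrt (g k.+1)) <=
    e * (B (v + g k.+1) w - B (v + g k) w))%R])) => k km.
  split; first exact: measure_ge0.
  have gk := grho k km; have g1 := g0 k; have g2 := g0 k.+1.
  (* Since [rho <= 2^-1], the factor 2 would do; [2 ^+ 2] has an exact root, which turns [K + 1]
     into [2 * K + 2]. *)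
  have gg : g k.+1 <= 2 ^+ 2 * (g k.+1 - g k) by nra.
  apply: (bm_increment_escape hB e1 c0).
  - by rewrite addr_ge0// ltW.
  - by rewrite ltrD2l; nra.
  - rewrite opprD addrACA subrr add0r.
    have -> : 2 * K + 2 = (K + 1) * 2 by ring.
    rewrite -mulrA; apply: ler_wpM2l; first by lra.
    apply: (@le_trans _ _ (Num.sqrt (2 ^+ 2 * (g k.+1 - g k)))); first by rewrite ler_sqrt//; nra.
    by rewrite sqrtrM ?sqr_ge0// sqrtr_sqr ger0_norm.
have PY k : (k < m)%N -> (P (A `&` Y k) <= P A * (6 * rho)%:E)%E.
  (* A future with a single increment, of variance [g k], at most [rho] times the squared threshold
     [g k.+1]; [u'] is then constant. *)
  move=> km; pose u' j := if j is k'.+1 then v + g k else v.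
  have u'nd : nondecreasing_seq u'.
    by apply/nondecreasing_seqP => -[|?]//=; rewrite lerDl ltW.
  have := @increments_past_future _ _ _ _ _ s u' a 1 (fun=> [set x : R | Num.sqrt (g k.+1) < `|x|]) A
    hB s0 snd u'nd erefl (fun=> measurable_normr_gt _) sA.
  rewrite big_ord1/= (_ : [set w | _] = Y k); last first.
    by apply/seteqP; split => w /= => [/(_ 0%N isT)//|Yw [|]].
  move=> ->; apply: lee_wpmul2l; first exact: measure_ge0.
  have g1 := g0 k; have g2 := g0 k.+1.
  have vg : v < v + g k by rewrite ltrDl.
  have sg : 0 < Num.sqrt (g k.+1) by rewrite sqrtr_gt0.
  apply: (le_trans (bm_increment_tail hB v0 vg sg)).
  rewrite lee_fin ler_pM2l// sqr_sqrtr; last exact: ltW.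
  by rewrite addrAC subrr add0r ler_pdivrMr// grho.
set S := [set w | _].
have mS : measurable S.
  apply: (measurable_rectangle m.+1 (X := fun k w => B (v + g k) w - B v w)
    (C := fun k => [set x | - (K * Num.sqrt (g k)) <= e * x])) => k.
    exact: measurable_funB.
  exact: measurable_mul_ge.
have mAY k : measurable (A `&` Y k) by exact: measurableI.
have mUY : measurable (\big[setU/set0]_(k < m) (A `&` Y k)).
  exact: bigsetU_measurable.
(* Off every [Y k], replacing the starting time [v] by [v + g k] changes the increment up to
   [v + g k.+1] by at most [sqrt (g k.+1)]: this raises [K] to the [K + 1] of [C]. *)
have SXY : A `&` S `<=` (A `&` X) `|` \big[setU/set0]_(k < m) (A `&` Y k).
  move=> w [Aw Sw]; have [[k km Yw]|nY] := pselect (exists2 k, (k < m)%N & Y k w).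
    by right; rewrite -(bigcup_mkord m (fun k => A `&` Y k)); exists k.
  left; split => // -[//|k] /=; rewrite ltnS => km.
  have := Sw k.+1 km; have : ~ Y k w by move=> Yw; apply: nY; exists k.
  rewrite /Y /= => /negP; rewrite -leNgt ler_norml => /andP[].
  by case: e1 => ->; rewrite ?mul1r ?mulN1r; lra.
have mAX : measurable (A `&` X) by exact: measurableI.
have mAS : measurable (A `&` S) by exact: measurableI.
apply: (@le_trans _ _ (P ((A `&` X) `|` \big[setU/set0]_(k < m) (A `&` Y k)))).
  by apply: le_measure; rewrite ?inE//; exact: measurableU.
apply: (le_trans (measureU2 _ _ _)) => //.
rewrite EFinD muleDr ?fin_num_measure//; apply: leeD => //.
apply: (@le_trans _ _ (\sum_(k < m) P (A `&` Y k))%E).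
  exact: (@content_subadditive _ _ _ P _ (fun k => A `&` Y k)).
apply: (@le_trans _ _ (\sum_(k < m) (P A * (6 * rho)%:E))%E).
  by apply: lee_sum => k _; exact: PY.
have /fineK <- := fin_num_measure P A mA.
by rewrite -!EFinM sumEFin sumr_const card_ord lee_fin -[leLHS]mulr_natl mulrCA.
Qed.

(** * Paths near a lone zero, seen on a grid *)

Lemma within_continuous_half_holder (R : realType) (f : R -> R) (a b C : R) :
  (forall x y, x \in `[a, b] -> y \in `[a, b] ->
    `|f y - f x| <= C * Num.sqrt `|y - x|) ->
  {within `[a, b], continuous f}.
Proof.
move=> fC; apply/subspace_continuousP => x /= xab.
apply/cvgrPdist_le => eps eps0.
pose C' := Num.max C 1; have C'0 : 0 < C' by rewrite lt_max ltr01 orbT.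
pose del := (eps / C') ^+ 2; have del0 : 0 < del by rewrite exprn_gt0// divr_gt0.
apply/(@nbhs_ballP R R^o); exists del => //= y /=; rewrite -ball_normE/= => xy yab.
rewrite distrC (le_trans (fC _ _ _ _))//.
apply: (@le_trans _ _ (C' * Num.sqrt del)).
  apply: (@le_trans _ _ (C' * Num.sqrt `|y - x|)).
    by rewrite ler_wpM2r// /C' le_max lexx.
  by rewrite ler_wpM2l ?(ltW C'0)// ler_sqrt ?(ltW del0)// distrC ltW.
by rewrite sqrtr_sqr ger0_norm ?divr_ge0 ?(ltW eps0) ?(ltW C'0)// mulrC divfK// gt_eqF.
Qed.

(** If [g x <= 0], the intermediate value theorem gives a zero in [[x, r]]; the interval starts at
    [x] because [g] may vanish at [t]. *)
Lemma nonzero_constant_sign (R : realType) (g : R -> R) (t r x : R) :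
  {within `[t, r], continuous g} -> (forall y, t < y <= r -> g y != 0) ->
  t < x <= r -> 0 < g r -> 0 < g x.
Proof.
move=> cg gn0 txr gr; rewrite ltNge; apply/negP => gx.
have /andP[tx xr] := txr.
have cg' : {within `[x, r], continuous g}.
  apply: continuous_subspaceW cg; apply: subset_itvr; rewrite bnd_simp; exact: ltW.
have [|y yxr gy0] := @IVT _ g x r 0 xr cg'.
  by rewrite ge_min gx/= le_max (ltW gr) orbT.
have : g y != 0.
  by apply: gn0; move: yxr; rewrite in_itv/= => /andP[xy ->]; rewrite (lt_le_trans tx).
by rewrite gy0 eqxx.
Qed.

Lemma first_index (p : pred nat) n : p n ->
  exists2 j, (j <= n)%N & p j /\ forall i, (i < j)%N -> ~~ p i.
Proof.
move=> pn; have ex : exists n, p n by exists n.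
case: (ex_minnP ex) => j pj jmin; exists j; first exact: jmin.
by split => // i ij; apply/negP => /jmin; rewrite leqNgt ij.
Qed.

Definition grid (R : realType) (q r : R) (n j : nat) : R :=
  q + j%:R * ((r - q) / n.+1%:R).

Lemma grid_le (R : realType) (q r : R) n j : q < r -> (j <= n.+1)%N ->
  q <= grid q r n j <= r.
Proof.
move=> qr jn; have qr0 : 0 < r - q by rewrite subr_gt0.
rewrite /grid lerDl mulr_ge0//=; last by rewrite divr_ge0 ?ltW.
rewrite -lerBrDl mulrCA ger_pMr// ler_pdivrMr// mul1r ler_nat//.
Qed.

Lemma grid_nondecreasing (R : realType) (q r : R) n : q < r ->
  nondecreasing_seq (grid q r n).
Proof.
move=> qr i j ij; rewrite lerD2l ler_wpM2r ?ler_nat//.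
by rewrite divr_ge0// subr_ge0 ltW.
Qed.

(** The first grid point not before [t] overshoots [t] by less than one mesh, and the mesh is below
    [eta] for large [n]. *)
Lemma grid_hit (R : realType) (q r t eta : R) : q < t -> t < r -> 0 < eta ->
  exists N, forall n, (N <= n)%N ->
    exists2 j, (j <= n.+1)%N & t <= grid q r n j < t + eta.
Proof.
move=> qt tr eta0; have qr : 0 < r - q by rewrite subr_gt0 (lt_trans qt).
exists (Num.truncn ((r - q) / eta)) => n Nn.
have ndel : (r - q) / n.+1%:R < eta.
  rewrite ltr_pdivrMr// mulrC -ltr_pdivrMr//.
  by rewrite (lt_le_trans (truncnS_gt _))// ler_nat ltnS.
have pn : t <= grid q r n n.+1.
  by rewrite /grid mulrC divfK// addrC subrK ltW.
have [[|j] jn [pj jmin]] := @first_index (fun j => t <= grid q r n j) n.+1 pn.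
  by move: pj; rewrite /grid mul0r addr0 leNgt qt.
exists j.+1 => //; rewrite pj/=.
have := jmin j (ltnSn j); rewrite -ltNge => gt.
rewrite /grid -natr1 mulrDl mul1r addrA; exact: ltrD.
Qed.

(** From the first grid point [x] with |b - f| <= eps, every [x + h k] lies in []t, r]], where
    [e * (b - f)] is positive. Hence e (b (x + h) - b x) > e (f (x + h) - f x) - eps >= - C sqrt h -
    eps, and eps <= sqrt h. *)
Lemma lone_zero_grid (R : realType) (b f : R -> R) (e C q r' r t : R)
    (h : R^nat) (m : nat) :
  e = 1 \/ e = -1 -> q < t -> t < r' ->
  (forall x y, x \in `[q, r] -> y \in `[q, r] ->
    `|f y - f x| <= C * Num.sqrt `|y - x|) ->
  {within `[q, r], continuous (fun x => b x - f x)} ->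
  b t = f t -> (forall x, q <= x < t -> b x - f x != 0) ->
  (forall x, t < x <= r -> 0 < e * (b x - f x)) ->
  (forall k, 0 < h k) -> nondecreasing_seq h -> h m <= r - r' ->
  exists2 eps0, 0 < eps0 & forall eps, 0 < eps <= eps0 ->
  exists N, forall n, (N <= n)%N ->
  exists2 j, (j <= n.+1)%N &
    [/\ `|b (grid q r' n j) - f (grid q r' n j)| <= eps,
        forall i, (i < j)%N -> eps < `|b (grid q r' n i) - f (grid q r' n i)| &
        forall k, (k <= m)%N -> - ((C + 1) * Num.sqrt (h k)) <=
          e * (b (grid q r' n j + h k) - b (grid q r' n j))].
Proof.
move=> e1 qt tr' fC cg bt gn0 gpos h0 hnd hm.
pose g x := b x - f x.
have hk k : (k <= m)%N -> h k <= r - r'.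
  by move=> km; apply: le_trans hm; exact: hnd.
have r'r : r' < r by rewrite -subr_gt0 (lt_le_trans (h0 m)).
(* This puts [a] in [[q, t[] with [a + h 0 > t]: every scale carries a point beyond [a] past [t]. *)
pose a := t - Num.min (h 0%N) (t - q) / 2.
have m0 : 0 < Num.min (h 0%N) (t - q) by rewrite lt_min h0 subr_gt0.
have [ma mb] : Num.min (h 0%N) (t - q) <= h 0%N /\
  Num.min (h 0%N) (t - q) <= t - q by split; rewrite ge_min lexx ?orbT.
have qa : q <= a by rewrite /a; lra.
have at_ : a < t by rewrite /a; lra.
have ta : t - a < h 0%N by rewrite /a; lra.
have cga : {within `[q, a], continuous (fun x => `|g x|)}.
  have cga : {within `[q, a], continuous g}.
    apply: continuous_subspaceW cg; apply: subset_itvl; rewrite bnd_simp; lra.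
  by move=> x; apply: continuous_comp; [exact: cga|exact: norm_continuous].
have [y0 y0qa y0min] := EVT_min qa cga.
have c0 : 0 < `|g y0|.
  rewrite normr_gt0; apply: gn0; move: y0qa; rewrite in_itv/= => /andP[-> /le_lt_trans].
  by apply.
(* The first bound keeps the points where |g| <= eps out of [[q, a]]; the second makes [eps] at most
   [sqrt (h k)] for every [k]. *)
exists (Num.min (`|g y0| / 2) (Num.sqrt (h 0%N))).
  by rewrite lt_min divr_gt0// sqrtr_gt0 h0.
move=> eps /andP[eps0]; rewrite le_min => /andP[epsc epsh].
have tqr : t \in `[q, r] by rewrite in_itv/=; apply/andP; split; lra.
have [eta eta0 etaP] : exists2 eta, 0 < eta &
    forall x, t <= x < t + eta -> x <= r -> `|g x| <= eps.
  move/subspace_continuousP : cg => /(_ t tqr) /cvgrPdist_le /(_ eps eps0).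
  move=> /(@nbhs_ballP R R^o)[eta/= eta0 etaP]; exists eta => // x /andP[tx xt] xr.
  have : `|g t - g x| <= eps.
    apply: etaP; last by rewrite in_itv/= xr andbT; lra.
    by rewrite -ball_normE/= distrC ger0_norm ?subr_ge0// ltrBlDl.
  by rewrite {1}/g bt subrr sub0r normrN.
have [N NP] := grid_hit qt tr' eta0; exists N => n Nn.
have qr' : q < r' by lra.
(* By continuity a grid point just after the zero [t] satisfies the bound, so a first index exists;
   its point may lie on either side of [t]. *)
have [j0 j0n /andP[tj0 j0t]] := NP n Nn.
have pj0 : `|g (grid q r' n j0)| <= eps.
  apply: etaP; first by rewrite tj0.
  by have /andP[_ ?] := grid_le qr' j0n; lra.
have [j jj0 [pj jmin]] := first_index (p := fun j => `|g (grid q r' n j)| <= eps) pj0.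
have jn := leq_trans jj0 j0n.
exists j => //; split => // [i ij|k km]; first by rewrite ltNge; exact: jmin.
have /andP[qj jr'] := grid_le qr' jn.
set x := grid q r' n j in pj qj jr' *.
have ax : a < x.
  rewrite ltNge; apply/negP => xa.
  have := y0min x; rewrite in_itv/= qj xa => /(_ isT) gx.
  by have := le_trans gx pj; lra.
have hk0 : h 0%N <= h k by exact: hnd.
have hkm := hk k km.
have xh : 0 < e * (b (x + h k) - f (x + h k)) by apply: gpos; apply/andP; split; lra.
have hk_gt0 := h0 k.
have fx : `|f (x + h k) - f x| <= C * Num.sqrt (h k).
  have := fC x (x + h k); rewrite (_ : x + h k - x = h k); last by ring.
  by rewrite (gtr0_norm hk_gt0) !in_itv/=; apply; apply/andP; split; lra.
have sh : eps <= Num.sqrt (h k) by rewrite (le_trans epsh)// ler_sqrt// ltW.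
move: pj fx xh; rewrite /g !ler_norml => /andP[? ?] /andP[? ?].
by case: e1 => ->; rewrite ?mul1r ?mulN1r; lra.
Qed.

(** * Limits inferior, null sets and first indices *)

(** The limit inferior of the events [E n]. *)
Definition eventually_in (T : Type) (E : nat -> set T) : set T :=
  [set w | exists N, forall n, (N <= n)%N -> E n w].

Lemma eventually_inE (T : Type) (E : nat -> set T) :
  eventually_in E = \bigcup_N \bigcap_(n in [set n | (N <= n)%N]) E n.
Proof.
by apply/seteqP; split => w [N]; [move=> H; exists N|move=> _ H; exists N].
Qed.

Lemma measurable_eventually_in (d : measure_display) (T : measurableType d)
    (E : nat -> set T) :
  (forall n, measurable (E n)) -> measurable (eventually_in E).
Proof.
move=> mE; rewrite eventually_inE; apply: bigcup_measurable => N _.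
by apply: bigcap_measurableType => n _; exact: mE.
Qed.

(** The intersections over [n >= N] increase with [N] and lie in [E N]; continuity from below passes
    the bound to their union. *)
Lemma eventually_in_le (d : measure_display) (T : measurableType d)
    (R : realType) (P : probability T R) (E : nat -> set T) (c : \bar R) :
  (forall n, measurable (E n)) -> (forall n, P (E n) <= c)%E ->
  (P (eventually_in E) <= c)%E.
Proof.
move=> mE Ec; rewrite eventually_inE.
set F := fun N => \bigcap_(n in [set n | (N <= n)%N]) E n.
have mF N : measurable (F N) by apply: bigcap_measurableType => n _; exact: mE.
have ndF : nondecreasing_seq F.
  by move=> N M NM; apply/subsetPset => w Fw n /= Mn; apply: Fw; exact: leq_trans Mn.
have /cvg_lim <- // := nondecreasing_cvg_mu (mu := P) mF (bigcup_measurable (fun k _ => mF k)) ndF.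
apply: lime_le; first by apply/cvg_ex; eexists; exact: nondecreasing_cvg_mu (bigcup_measurable (fun k _ => mF k)) ndF.
apply: nearW => N /=; apply: le_trans (Ec N); apply: le_measure; rewrite ?inE//.
by move=> w; apply => /=.
Qed.

(** No measurability of [S] is assumed: intersecting covers of probability at most 1 / (n + 1) gives
    a measurable null set around it. *)
Lemma negligible_small (d : measure_display) (T : measurableType d)
    (R : realType) (P : probability T R) (S : set T) :
  (forall eta : R, 0 < eta -> exists L : set T,
    [/\ measurable L, S `<=` L & (P L <= eta%:E)%E]) -> P.-negligible S.
Proof.
move=> SL.
have /choice[L LP] (n : nat) : exists L : set T,
    [/\ measurable L, S `<=` L & (P L <= (n.+1%:R^-1 : R)%:E)%E].
  by apply: SL; rewrite invr_gt0.
have mL : measurable (\bigcap_n L n).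
  by apply: bigcap_measurableType => n _; have [] := LP n.
exists (\bigcap_n L n); split => //; last by move=> w Sw n _; have [_ + _] := LP n; exact.
apply/eqP; rewrite eq_le measure_ge0 andbT.
apply/lee_addgt0Pr => eps eps0; rewrite add0e.
have nP := truncnS_gt eps^-1; set n := Num.truncn _ in nP.
have [mLn _ PLn] := LP n.
apply: (@le_trans _ _ (P (L n))).
  by apply: le_measure; rewrite ?inE// => w; exact.
apply: (le_trans PLn); rewrite lee_fin -[leRHS]invrK lef_pV2 ?posrE ?invr_gt0//.
exact: ltW.
Qed.

(** Total probability: the disjoint [A j] have probabilities of sum at most 1, so a common bound [c]
    on the conditional probabilities survives. This is where the events of a stopping index are put
    together. *)
Lemma disjoint_mixture_le (d : measure_display) (T : measurableType d)
    (R : realType) (P : probability T R) (A S : nat -> set T) (c : R) (n : nat) :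
  (forall j, measurable (A j)) -> (forall j, measurable (S j)) ->
  trivIset setT A -> 0 <= c ->
  (forall j, (j < n)%N -> P (A j `&` S j) <= P (A j) * c%:E)%E ->
  (P (\big[setU/set0]_(j < n) (A j `&` S j)) <= c%:E)%E.
Proof.
move=> mA mS tA c0 AS.
have mAS j : measurable (A j `&` S j) by exact: measurableI.
have mU : measurable (\big[setU/set0]_(j < n) (A j `&` S j)).
  exact: bigsetU_measurable.
apply: (@le_trans _ _ (\sum_(j < n) P (A j `&` S j))%E).
  exact: (@content_subadditive _ _ _ P _ (fun j => A j `&` S j)).
apply: (@le_trans _ _ (\sum_(j < n) (P (A j) * c%:E))%E).
  by apply: lee_sum => j _; exact: AS.
rewrite -ge0_sume_distrl// -measure_bigsetU//.
rewrite -[leRHS]mul1e lee_wpmul2r// ?lee_fin//.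
by apply: probability_le1; exact: bigsetU_measurable.
Qed.

Definition first_close (R : realType) (T : Type) (W : nat -> T -> R) (eps : R) (j : nat) : set T :=
  [set w | `|W j w| <= eps /\ forall i, (i < j)%N -> eps < `|W i w|].

Lemma trivIset_first_close (R : realType) (T : Type) (W : nat -> T -> R) eps :
  trivIset setT (first_close W eps).
Proof.
apply/trivIsetP => i j _ _ ij; apply/seteqP; split => // w [].
wlog lt_ij : i j {ij} / (i < j)%N.
  move=> H Wi Wj; case: (ltngtP i j) ij => // ij _.
    exact: (H i j).
  exact: (H j i).
by move=> [Wi _] [_ /(_ i lt_ij)]; rewrite ltNge Wi.
Qed.

(** Measurability is asked of [W i] for [i <= j] only, so that [T] may carry the sigma-algebra of
    the past. *)
Lemma measurable_first_close (R : realType) (d : measure_display)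
    (T : measurableType d) (W : nat -> T -> R) eps j :
  (forall i, (i <= j)%N -> measurable_fun setT (W i)) ->
  measurable (first_close W eps j).
Proof.
move=> mW.
rewrite [X in measurable X](_ : _ = (W j @^-1` ~` [set x | eps < `|x|]) `&`
   \bigcap_(i in `I_j) (W i @^-1` [set x | eps < `|x|])).
  apply: measurableI.
    rewrite -[X in measurable X]setTI; apply: mW => //.
    by apply: measurableC; exact: measurable_normr_gt.
  apply: bigcap_measurableType => i /= ij.
  by rewrite -[X in measurable X]setTI; apply: mW; [exact: ltnW|by []|exact: measurable_normr_gt].
by apply/seteqP; split => w [Wj Wi]; split => //=; move: Wj => /=; rewrite leNgt => /negP.
Qed.

(** B (s i.+1) - B (s 0) is a telescoping sum of increments and [z i] is deterministic. Index [j]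
    involves time [s j.+1], hence [j.+1] increments. *)
Lemma first_close_past (d : measure_display) (T : measurableType d)
    (R : realType) (P : probability T R) (B : R -> {RV P >-> R}) (s z : R^nat)
    (eps : R) (j : nat) :
  <<s rectangles (fun j w => B (s j.+1) w - B (s j) w) j.+1 >>
    (first_close (fun i w => B (s i.+1) w - B (s 0%N) w - z i) eps j).
Proof.
set X := fun j w => B (s j.+1) w - B (s j) w.
pose G := g_sigma_algebraType (rectangles X j.+1).
apply: (@measurable_first_close R _ G) => i ij; apply: measurable_funB => //.
elim: i ij => [|i IH] ij; first exact: (measurable_fun_rectangles (X := X)).
have -> : (fun w => B (s i.+2) w - B (s 0%N) w) =
    (fun w => (B (s i.+1) w - B (s 0%N) w) + X i.+1 w).
  by apply/funext => w; rewrite /X; ring.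
apply: measurable_funD; first exact: IH (ltnW ij).
exact: (measurable_fun_rectangles (X := X)).
Qed.

(** * Negligibility of a lone zero for fixed end points and sign *)

Lemma exp_le_small (R : realType) (x eta : R) : 0 <= x < 1 -> 0 < eta ->
  exists m, x ^+ m <= eta.
Proof.
move=> /andP[x0 x1] eta0.
have /cvgrPdist_le/(_ eta eta0)[m _ /(_ m (leqnn m))] : (fun m => x ^+ m) @ \oo --> 0.
  by apply: cvg_expr; rewrite ger0_norm.
by rewrite sub0r normrN => H; exists m; apply: le_trans H; exact: ler_norm.
Qed.

(** Given [eta], the choice of [m] and then of [rho] makes the bound of [bm_stay_le] at most [eta],
    uniformly in [eps] and the grid, and limits inferior keep it. *)
Lemma lone_zero_negligible (d : measure_display) (T : measurableType d)
    (R : realType) (P : probability T R) (B : R -> {RV P >-> R}) (f : R -> R)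
    (e C q r' r : R) :
  standard_brownian_motion B -> e = 1 \/ e = -1 -> 0 <= C ->
  0 <= q -> q < r' -> r' < r ->
  (forall x y, x \in `[q, r] -> y \in `[q, r] ->
    `|f y - f x| <= C * Num.sqrt `|y - x|) ->
  P.-negligible [set w | [/\ B 0 w = 0,
    {within `[q, r], continuous (fun t => B t w - f t)} &
    exists t, [/\ q < t < r', B t w = f t,
      forall x, q <= x < t -> B x w - f x != 0 &
      forall x, t < x <= r -> 0 < e * (B x w - f x)]]].
Proof.
move=> hB e1 C0 q0 qr' r'r fC; apply: negligible_small => eta eta0.
have K0 : 0 <= C + 1 by lra.
have c0 : 0 <= 2 * (C + 1) + 2 by lra.
set p := escape_prob (2 * (C + 1) + 2).
have p0 : 0 < p by exact: escape_prob_gt0.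
have p1 : 0 <= 1 - p < 1.
  apply/andP; split; last by lra.
  rewrite -lee_fin; apply: le_trans (normal_prob_escape e1 ltr01 c0).
  exact: measure_ge0.
have [||m pm] := @exp_le_small _ (1 - p) (eta / 2) => //; first by rewrite divr_gt0.
(* The constant 12 gives 6 m rho <= eta / 2, the other half of [eta] being spent on (1 - p)^m;
   [m.+1] keeps the denominator nonzero. *)
pose rho := Num.min 2^-1 (eta / (12 * m.+1%:R)).
have rho0 : 0 < rho by rewrite lt_min invr_gt0 ltr0n/= divr_gt0 ?mulr_gt0.
have rho2 : rho <= 2^-1 by rewrite ge_min lexx.
have mrho : m%:R * (6 * rho) <= eta / 2.
  apply: (@le_trans _ _ (m.+1%:R * (6 * rho))).
    by rewrite ler_wpM2r ?ler_nat// mulr_ge0 ?(ltW rho0).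
  have : rho <= eta / (12 * m.+1%:R) by rewrite ge_min lexx orbT.
  rewrite ler_pdivlMr ?mulr_gt0//; lra.
(* Scales growing by the factor 1 / rho up to the available room [r - r']; beyond [m] the truncated
   subtraction makes [h] constant. *)
pose h k := (r - r') * rho ^+ (m - k).
have h0 k : 0 < h k by rewrite mulr_gt0 ?exprn_gt0 ?subr_gt0.
have hnd : nondecreasing_seq h.
  move=> i j ij; rewrite ler_pM2l ?subr_gt0//.
  apply: ler_wiXn2l; [exact: ltW|by lra|exact: leq_sub2l].
have hm : h m <= r - r' by rewrite /h subnn expr0 mulr1.
have hrho k : (k < m)%N -> h k <= rho * h k.+1.
  by move=> km; rewrite /h mulrCA -exprS -subSn.
(* Time 0 precedes the grid, so that [W] is built from increments and grid index [i] becomes [i.+1].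
   Where [B 0 w = 0], [W n i w] is the value of [B - f] at the grid point. *)
pose s n j := if j is i.+1 then grid q r' n i else 0.
have snd n : nondecreasing_seq (s n).
  apply/nondecreasing_seqP => -[|i]/=; last exact: grid_nondecreasing.
  by have /andP[+ _] := @grid_le _ q r' n 0 qr' isT; exact: le_trans.
pose W n i w := B (s n i.+1) w - B (s n 0%N) w - f (grid q r' n i).
pose A eps n j := first_close (W n) eps j.
pose S n j := [set w | forall k, (k <= m)%N ->
  - ((C + 1) * Num.sqrt (h k)) <= e * (B (s n j.+1 + h k) w - B (s n j.+1) w)].
pose E eps n := \big[setU/set0]_(j < n.+2) (A eps n j `&` S n j).
have pA eps n j : <<s rectangles (fun j w => B (s n j.+1) w - B (s n j) w) j.+1 >>
    (A eps n j) by exact: first_close_past.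
have mA eps n j : measurable (A eps n j) by exact: measurable_past (pA eps n j).
have mS n j : measurable (S n j).
  apply: (measurable_rectangle m.+1 (X := fun k w => B (s n j.+1 + h k) w - B (s n j.+1) w)
    (C := fun k => [set x | - ((C + 1) * Num.sqrt (h k)) <= e * x])) => k.
    exact: measurable_funB.
  exact: measurable_mul_ge.
have mE eps n : measurable (E eps n).
  by apply: bigsetU_measurable => j _; exact: measurableI.
have PE eps n : (P (E eps n) <= eta%:E)%E.
  apply: disjoint_mixture_le => //; [exact: trivIset_first_close|exact: ltW|].
  move=> j _.
  apply: (le_trans (bm_stay_le hB e1 K0 rho2 (lexx 0) (snd n) h0 hnd hrho (pA eps n j))).
  by rewrite lee_wpmul2l ?measure_ge0// lee_fin; lra.
(* The thresholds for [eps = 1 / (i + 1)] and for [n] depend on the path, whence two nested limits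
   inferior. *)
exists (eventually_in (fun i => eventually_in (E i.+1%:R^-1))).
have mEE i : measurable (eventually_in (E i.+1%:R^-1)).
  exact: measurable_eventually_in.
split; first exact: measurable_eventually_in.
- move=> w [Bw0 cw [t [/andP[qt tr'] Bt Bn0 Bpos]]].
  have [eps0 eps00 H] := lone_zero_grid e1 qt tr' fC cw Bt Bn0 Bpos h0 hnd hm.
  exists (Num.truncn eps0^-1) => i Ni.
  have [|N NP] := H i.+1%:R^-1.
    rewrite invr_gt0 ltr0n/= -[leRHS]invrK lef_pV2 ?posrE ?invr_gt0//.
    by apply: ltW; rewrite (lt_le_trans (truncnS_gt _))// ler_nat ltnS.
  exists N => n Nn; have [j jn [Hj Hi Hk]] := NP n Nn.
  rewrite /E -(bigcup_mkord n.+2 (fun j => A _ n j `&` S n j)); exists j => //=.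
  by split => //; split => [|i' ij]; rewrite /W /= Bw0 subr0//; exact: Hi.
- by apply: eventually_in_le => // i; exact: eventually_in_le.
Qed.

(** * Reduction to countably many rational data *)

Lemma rational_between (R : realType) (x y : R) : x < y ->
  exists q : rat, x < ratr q < y.
Proof. by move=> /rat_in_itvoo[q]; rewrite in_itv/=; exists q. Qed.

(** The rationals are taken in a neighbourhood of [t] without other zeros; the gap between [r'] and
    [r] is the room for the scales, and the sign is a boolean so that all the data are countable. *)
Lemma isolated_lone_zero (R : realType) (g : R -> R) (t : R) :
  (forall a b, 0 <= a -> a <= b -> {within `[a, b], continuous g}) ->
  isolated (zeros g) t ->
  exists (b : bool) (q r' r : rat),
    [/\ 0 <= ratr q :> R, ratr q < t < ratr r', ratr r' < ratr r :> R,
      forall x, ratr q <= x < t -> g x != 0 &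
      forall x, t < x <= ratr r -> 0 < (-1) ^+ b * g x].
Proof.
move=> cg [/set_mem[t0 gt0] [V Vt VZ]].
have /(@nbhs_ballP R R^o)[eps /= eps0 epsV] := Vt.
have gn0 x : 0 < x -> t - eps < x < t + eps -> x != t -> g x != 0.
  move=> x0 /andP[xl xr] xt; apply/eqP => gx.
  have : (V `&` zeros g) x.
    split; last by [].
    by apply: epsV; rewrite -ball_normE/= ltr_distlC xl xr.
  by rewrite VZ => /= xE; rewrite xE eqxx in xt.
(* The maximum with 0 keeps [q] positive, as [zeros] only sees positive times. *)
have [q /andP[]] : exists q : rat, Num.max 0 (t - eps) < ratr q < t.
  by apply: rational_between; rewrite gt_max t0 ltrBlDr ltrDl.
rewrite gt_max => /andP[q0 qe] qt.
have [r' /andP[tr' r'e]] : exists q : rat, t < ratr q < t + eps.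
  by apply: rational_between; rewrite ltrDl.
have [r /andP[r'r re]] := rational_between r'e.
have gr x : t < x <= ratr r -> g x != 0.
  move=> /andP[tx xr]; apply: gn0; [by lra|by apply/andP; split; lra|].
  by rewrite gt_eqF.
exists (g (ratr r) < 0), q, r', r; split => //; first exact: ltW.
- by rewrite qt tr'.
- move=> x /andP[qx xt]; apply: gn0; [by lra|by apply/andP; split; lra|].
  by rewrite lt_eqF.
- have grr : g (ratr r) != 0 by apply: gr; apply/andP; split; lra.
  set s : R := (-1) ^+ _; have s0 : s != 0 by rewrite signr_eq0.
  move=> x txr; apply: (@nonzero_constant_sign _ (fun y => s * g y) t (ratr r)) => //.
  + have ctr := cg t (ratr r) (ltW t0) (ltW (lt_trans tr' r'r)).
    have cs : continuous ( *%R s : R -> R) by move=> y; exact: mulrl_continuous.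
    by move=> y; exact: (continuous_comp (ctr y) (cs (g y))).
  + by move=> y /gr gy; rewrite mulf_neq0.
  + by rewrite /s neqr0_sign// -normrEsg normr_gt0.
Qed.

Lemma negligible_bigcup_countable (d : measure_display) (T : measurableType d)
    (R : realType) (mu : {measure set T -> \bar R}) (I : countType)
    (N : I -> set T) :
  (forall i, mu.-negligible (N i)) -> mu.-negligible (\bigcup_i N i).
Proof.
move=> nN.
pose M n := if unpickle n is Some i then N i else set0.
apply: (@negligibleS _ _ _ _ (\bigcup_n M n)).
  by move=> w [i _ Niw]; exists (pickle i) => //; rewrite /M pickleK.
apply: negligible_bigcup => n; rewrite /M; case: unpickle => [i|]; first exact: nN.
exact: negligible_set0.
Qed.

Theorem proposition1p1 (d : measure_display) (T : measurableType d)
    (R : realType) (P : probability T R) (B : R -> {RV P >-> R}) (f : R -> R)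
    (hB : standard_brownian_motion B) (hf : half_holder_on_compacts f) :
  {ae P, forall w, isolated (zeros (fun t : R => B t w - f t)) = set0}.
Proof.
have fC (a b : R) : 0 <= a -> a <= b -> exists2 C : R, 0 <= C &
    forall x y : R, x \in `[a, b] -> y \in `[a, b] ->
    `|f y - f x| <= C * Num.sqrt `|y - x|.
  move=> a0 ab; have [C HC] := hf a b a0 ab; exists (Num.max C 0).
    by rewrite le_max lexx orbT.
  move=> x y xab yab; apply: (le_trans (HC x y xab yab)).
  by rewrite powR12_sqrt// ler_wpM2r// le_max lexx.
(* All quadruples are allowed as indices; the order of the end points is part of the event, which is
   empty when it fails. *)
pose N (i : bool * rat * rat * rat) : set T :=
  let: (b, q, r', r) := i in
  [set w | [/\ 0 <= ratr q :> R, ratr q < ratr r' :> R & ratr r' < ratr r :> R] /\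
    [/\ B 0 w = 0,
    {within `[ratr q, ratr r], continuous (fun t => B t w - f t)} &
    exists t, [/\ ratr q < t < ratr r', B t w = f t,
      forall x, ratr q <= x < t -> B x w - f x != 0 &
      forall x, t < x <= ratr r -> 0 < (-1) ^+ b * (B x w - f x)]]].
have nN i : P.-negligible (N i).
  move: i => [[[b q] r'] r]; rewrite /N.
  have [[q0 qr' r'r]|nqr] := pselect ([/\ 0 <= ratr q :> R,
      ratr q < ratr r' :> R & ratr r' < ratr r :> R]); last first.
    by apply: negligibleS (negligible_set0 P) => w [].
  have [C C0 HC] := fC _ _ q0 (ltW (lt_trans qr' r'r)).
  have b1 : (-1) ^+ b = 1 :> R \/ (-1) ^+ b = -1 :> R by case: b; [right|left].
  apply: negligibleS (lone_zero_negligible hB b1 C0 q0 qr' r'r HC).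
  by move=> w [].
have : {ae P, forall w, ~ (\bigcup_i N i) w}.
  have nU : P.-negligible (\bigcup_i N i) by exact: negligible_bigcup_countable.
  rewrite /almost_everywhere; apply: negligibleS nU.
  by move=> w /= /contrapT.
apply: filterS3 (bm_start hB) (bm_continuous hB) => w B0 cB nNw.
apply/seteqP; split => // t tiso.
have cg a b : 0 <= a -> a <= b -> {within `[a, b], continuous (fun t => B t w - f t)}.
  move=> a0 ab; apply: within_continuousB.
    apply: continuous_subspaceW cB => x /=; rewrite !in_itv/= andbT => /andP[ax _].
    exact: le_trans ax.
  by have [C _ HC] := fC a b a0 ab; exact: within_continuous_half_holder HC.
have [b [q [r' [r [q0 /andP[qt tr'] r'r gn0 gpos]]]]] := isolated_lone_zero cg tiso.
apply: nNw; exists (b, q, r', r) => //; split.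
  by split => //; exact: lt_trans tr'.
split => //; first by apply: cg => //; apply: ltW; rewrite (lt_trans qt)// (lt_trans tr').
exists t; split => //; first by rewrite qt tr'.
by move: tiso => [/set_mem[_ /eqP]]; rewrite subr_eq0 => /eqP.
Qed.
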